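(* If $\lambda<1$, then under the SA-JSQ scheme, for each $j\in[M]$, each $k\in[N\gamma_j]$, each $l\ge1$ and all $\theta\in[0,-\log\lambda)$, $$\sup_N\ \mathbb{P}\big(Q^{(N)}_{k,j}(\infty)\ge l\big)\ \le\ C_j(\lambda,\theta)\,e^{-l\theta},\qquad C_j(\lambda,\theta)=\frac{1-\lambda}{\mu_j\gamma_j(1-\lambda e^{\theta})}>0 .$$
   Context: Parameters: $M\in\{1,2,\dots\}$; service rates $\mu_1>\dots>\mu_M>0$; proportions $\gamma_j\in(0,1]$ with $\sum_j\gamma_j=1$ and $\sum_j\gamma_j\mu_j=1$; $\lambda>0$; $N$ ranges over positive integers with $N\gamma_j\in\{1,2,\dots\}$ for all $j\in[M]=\{1,\dots,M\}$ (for given $k,j$ the supremum is over those $N$ with $k\le N\gamma_j$). System: $N$ servers, $N\gamma_j$ of type $j$ with service rate $\mu_j$, each with its own infinite-buffer FCFS queue; Poisson arrivals of rate $N\lambda$; i.i.d. exponential job sizes of mean $1$. Speed-Aware JSQ (SA-JSQ): each arriving job joins a server with the minimum queue length among all servers; ties between types are broken in favour of the fastest type (smallest $j$), ties within a type uniformly at random. $\mathbf{Q}^{(N)}(t)=(Q^{(N)}_{k,j}(t),k\in[N\gamma_j],j\in[M])\in\mathbb{Z}_+^N$, where $Q^{(N)}_{k,j}(t)$ is the number of jobs (including the one in service) at the $k$-th type $j$ server. It is the Markov chain with rates, from state $\mathbf{Q}$: $\mathbf{Q}\to\mathbf{Q}+\mathbf{e}_{k,j}$ at rate $N\lambda/|I_{\min,j}(\mathbf{Q})|$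 if $j=j^\dagger(\mathbf{Q})$ and $k\in I_{\min,j}(\mathbf{Q})$ (rate $0$ otherwise), and $\mathbf{Q}\to\mathbf{Q}-\mathbf{e}_{k,j}$ at rate $\mu_j\mathbf{1}(Q_{k,j}>0)$. Here $I_{\min,j}(\mathbf{Q})$ is the set of servers of minimum queue length within pool $j$, and $j^\dagger(\mathbf{Q})$ is the smallest index $j$ of a pool containing a server of globally minimum queue length. For $\lambda<1$ this chain is positive recurrent, and $\mathbf{Q}^{(N)}(\infty)=(Q^{(N)}_{k,j}(\infty))$ denotes a random state distributed according to its unique stationary distribution. *)

(* Defs.v *)
From HB Require Import structures.
From mathcomp Require Import all_boot all_order all_algebra.
From mathcomp Require Import all_classical all_reals all_analysis.

Set Implicit Arguments.
Unset Strict Implicit.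
Unset Printing Implicit Defensive.

Import Order.TTheory GRing.Theory Num.Theory.
Import numFieldNormedType.Exports.

Local Open Scope classical_set_scope.
Local Open Scope ring_scope.

(* Server [Tagged _ i] with tag [j] is the [i.+1]-th server of pool [j];
   pool [j] has [n j] servers. Pools, like servers, are numbered from 0. *)
Definition server (M : nat) (n : 'I_M -> nat) := {j : 'I_M & 'I_(n j)}.
HB.instance Definition _ M n := Finite.on (@server M n).

Definition mkserver (M : nat) (n : 'I_M -> nat) (j : 'I_M) (i : 'I_(n j)) :
  server n := Tagged (fun j => 'I_(n j)) i.

Definition state (M : nat) (n : 'I_M -> nat) := {ffun server n -> nat}.
HB.instance Definition _ M n := Countable.on (@state M n).
HB.instance Definition _ M n := isPointed.Build (@state M n) [ffun=> 0%N].

(* The state space is countable; it carries the discrete sigma-algebra. *)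
HB.instance Definition _ M n := @isMeasurable.Build default_measure_display
  (@state M n) discrete_measurable discrete_measurable0
  discrete_measurableC discrete_measurableU.

Definition pool_sizes (R : realType) (M : nat) (gamma : 'I_M -> R) (N : nat)
    (n : 'I_M -> nat) : Prop :=
  forall j, (0 < n j)%N /\ (n j)%:R = N%:R * gamma j.

Section SAJSQ.
Context (R : realType) (M : nat) (n : 'I_M -> nat).
Implicit Types (Q : state n) (s : server n) (j : 'I_M).

(* Q + e_s and Q - e_s; the subtraction is truncated, but departures from
   an empty server have rate 0. *)
Definition incr Q s : state n := [ffun r => (Q r + (r == s))%N].
Definition decr Q s : state n := [ffun r => (Q r - (r == s))%N].

Definition pool_argmin Q j : {set 'I_(n j)} :=
  [set i : 'I_(n j) | [forall i' : 'I_(n j),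
     (Q (mkserver i) <= Q (mkserver i'))%N]].

Definition has_global_min Q j : bool :=
  [exists i : 'I_(n j), [forall s : server n, (Q (mkserver i) <= Q s)%N]].

Definition is_jdagger Q j : bool :=
  has_global_min Q j &&
  [forall j' : 'I_M, has_global_min Q j' ==> (j <= j')%N].

Definition arrival_rate (N : nat) (lambda : R) Q s : R :=
  if is_jdagger Q (tag s) && (tagged s \in pool_argmin Q (tag s))
  then N%:R * lambda / #|pool_argmin Q (tag s)|%:R else 0.

Definition service_rate (mu : 'I_M -> R) Q s : R :=
  if (0 < Q s)%N then mu (tag s) else 0.

(* The off-diagonal entries are the jump rates; the diagonal entry is minus
   the total jump rate out of the state. *)
Definition sajsq_generator (N : nat) (lambda : R) (mu : 'I_M -> R)
    Q Q' : R :=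
  \sum_(s : server n) arrival_rate N lambda Q s *
    ((Q' == incr Q s)%:R - (Q' == Q)%:R) +
  \sum_(s : server n) service_rate mu Q s *
    ((Q' == decr Q s)%:R - (Q' == Q)%:R).

End SAJSQ.

Section markov.
Context (R : realType) (d : measure_display) (T : measurableType d).
Local Open Scope ereal_scope.

(* [P t x] is the law at time [t] of the chain started at [x]; only times
   [t >= 0] matter. The last clause says that [G] collects the
   infinitesimal rates of the chain. *)
Definition is_transition_function (G : T -> T -> R)
    (P : R -> R.-pker T ~> T) : Prop :=
  [/\ forall x A, measurable A -> P 0%R x A = \d_x A,
      forall s t x A, (0 <= s)%R -> (0 <= t)%R -> measurable A ->
        P (s + t)%R x A = \int[P s x]_y P t y A
    & forall x y,
        (((fine (P t x [set y]) - fine (P 0%R x [set y])) / t)%R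
          @[t --> 0^'+] --> G x y)%classic].

Definition is_invariant (P : R -> R.-pker T ~> T) (pi : probability T R) :
    Prop :=
  forall t A, (0 <= t)%R -> measurable A -> \int[pi]_x P t x A = pi A.

(* [pi] is a stationary distribution of the Markov chain with rates [G] *)
Definition is_stationary (G : T -> T -> R) (pi : probability T R) : Prop :=
  exists P, is_transition_function G P /\ is_invariant P pi.

End markov.

(* Main.v *)
Require Import Defs.
From HB Require Import structures.
From mathcomp Require Import all_boot all_order all_algebra.
From mathcomp Require Import all_classical all_reals all_analysis.
From mathcomp Require Import perm ring lra zify.
Set Implicit Arguments.
Unset Strict Implicit.
Unset Printing Implicit Defensive.
Import Order.TTheory GRing.Theory Num.Theory.
Import numFieldNormedType.Exports.
Local Open Scope classical_set_scope.
Local Open Scope ring_scope.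

(* The jump rates are bounded, so a stationary law gives mean zero to the
   drift of every bounded function. For
   f = sum_s (min (Q_s, l + m) - min (Q_s, l)), arrivals contribute only in
   states where every queue is at least l, since they join a shortest queue, and
   sum_s mu_s = N; letting m go to infinity,
     T (l + 1) <= lambda * T l,  where T l = sum_s mu_s P (Q_s >= l), T 0 = N.
   Hence T l <= lambda ^ l * N. Servers of the same pool are exchangeable because
   the stationary law is unique, so mu_j gamma_j P (Q_{k,j} >= l) <= lambda ^ l,
   and this is sharper than the claim: (lambda e^theta) ^ l <= 1 and
   1 <= (1 - lambda) / (1 - lambda e^theta). *)

(** * Stationarity in terms of the jump rates *)

Section discrete_expectation.
Context (R : realType) (d : measure_display) (T : measurableType d).
Hypothesis all_measurable : forall A : set T, measurable A.

Lemma discrete_measurable_fun (d' : measure_display) (U : sigmaRingType d')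
  (D : set T) (f : T -> U) : measurable_fun D f.
Proof. by move=> _ Y _; exact: all_measurable. Qed.

Context (pi : probability T R).

Lemma bounded_integrable (f : T -> R) (C : R) :
  (forall x, `|f x| <= C) -> pi.-integrable setT (EFin \o f).
Proof.
move=> fC.
apply: (@le_integrable _ _ _ _ _ _ _ (EFin \o cst C)) => //.
- move=> x _ /=; rewrite lee_fin (le_trans (fC x))//.
  exact: ler_norm.
- exact: finite_measure_integrable_cst.
Qed.

(** Dominated convergence: a constant is integrable against a probability. *)
Lemma bounded_Rintegral_cvg (f_ : nat -> T -> R) (f : T -> R) (C : R) :
  (forall m x, `|f_ m x| <= C) -> (forall x, f_ m x @[m --> \oo] --> f x) ->
  (\int[pi]_x f_ m x) @[m --> \oo] --> \int[pi]_x f x.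
Proof.
move=> fC cf.
have cf' : \forall x \ae pi, setT x ->
    (f_ m x)%:E @[m --> \oo] --> (f x)%:E.
  by apply: aeW => x _; apply: cvg_EFin (cf x); exact: nearW.
have fC' : \forall x \ae pi, forall m, setT x -> (`|(f_ m x)%:E| <= C%:E)%E.
  by apply: aeW => x m _; rewrite lee_fin.
have [fi _ h] := @dominated_convergence _ _ _ pi setT measurableT
  (fun m x => (f_ m x)%:E) (fun x => (f x)%:E) (EFin \o cst C)
  (fun m => discrete_measurable_fun _) (discrete_measurable_fun _)
  cf' (finite_measure_integrable_cst pi C measurableT) fC'.
apply: fine_cvg; rewrite fineK//.
exact: integrable_fin_num.
Qed.

Lemma bounded_Rintegral_sum (I : Type) (r : seq I) (P : pred I) (c : I -> R)
    (f : I -> T -> R) (C : R) : (forall i x, `|f i x| <= C) ->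
  \int[pi]_x (\sum_(i <- r | P i) c i * f i x) =
  \sum_(i <- r | P i) c i * \int[pi]_x f i x.
Proof.
move=> fC.
pose K (s : seq I) := \sum_(i <- s | P i) `|c i| * C.
have bd s x : `|\sum_(i <- s | P i) c i * f i x| <= K s.
  rewrite (le_trans (ler_norm_sum _ _ _))// ler_sum// => i _.
  by rewrite normrM ler_wpM2l.
elim: r => [|i r IH].
  under eq_Rintegral do rewrite big_nil.
  by rewrite big_nil Rintegral_cst// mul0r.
under eq_Rintegral do rewrite big_cons.
rewrite big_cons; case: ifPn => Pi //.
rewrite RintegralD//=.
- rewrite IH RintegralZl//.
  exact: (bounded_integrable (fC i)).
- apply: (@bounded_integrable _ (`|c i| * C)) => x.
  by rewrite normrM ler_wpM2l.
- exact: (bounded_integrable (bd r)).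
Qed.

End discrete_expectation.

(** * Difference quotients of the transition probabilities *)

Section infinitesimal_stationarity.
Context (R : realType) (d : measure_display) (T : measurableType d).
Hypothesis all_measurable : forall A : set T, measurable A.
Context (G : T -> T -> R) (P : R -> R.-pker T ~> T).
Hypothesis GP : is_transition_function G P.

Let p t x y := fine (P t x [set y]).

Let P_le1 t x (A : set T) : (P t x A <= 1)%E.
Proof. by rewrite -(@prob_kernel _ _ _ _ _ (P t) x) le_measure// inE. Qed.

Let P_fin t x A : P t x A \is a fin_num.
Proof. by rewrite ge0_fin_numE// (le_lt_trans (P_le1 _ _ _))// ltry. Qed.

Let pE t x y : P t x [set y] = (p t x y)%:E.
Proof. by rewrite /p fineK. Qed.

Let p_ge0 t x y : 0 <= p t x y.
Proof. by rewrite fine_ge0. Qed.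

Let p_le1 t x y : p t x y <= 1.
Proof. by rewrite -lee_fin -pE P_le1. Qed.

Let p0E x y : p 0 x y = (x == y)%:R.
Proof.
have [P0 _ _] := GP.
rewrite /p P0// diracE; congr (_%:R); congr nat_of_bool.
by apply/idP/eqP => [|->]; rewrite ?inE.
Qed.

Let pxx_sub t x y : x != y -> p t x y <= 1 - p t x x.
Proof.
move=> xy; rewrite lerBrDr -lee_fin EFinD -!pE.
rewrite -measureU//; first exact: P_le1.
by apply/seteqP; split => z //= [-> yx]; move: xy; rewrite yx eqxx.
Qed.

(** Chapman-Kolmogorov, keeping only the paths that are at [x] at time [s]. *)
Let p_mul s t x : 0 <= s -> 0 <= t -> p s x x * p t x x <= p (s + t) x x.
Proof.
move=> s0 t0; have [_ PD _] := GP.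
rewrite -lee_fin -pE PD// [leRHS](_ : _ = \int[P s x]_y (p t y x)%:E)%E; last first.
  by apply: eq_integral => y _; rewrite pE.
rewrite mulrC EFinM -(pE s) -[X in P s x X]setIT -integral_indic//.
rewrite -ge0_integralZl_EFin//.
apply: ge0_le_integral => //.
  by move=> y _; rewrite mule_ge0// lee_fin.
move=> y _; rewrite -EFinM lee_fin indicE.
by case: (boolP (y \in _)) => [|_]; rewrite ?inE ?mulr0//= => ->; rewrite mulr1.
Qed.

(** Induction with [p_mul], since [1 - a * b <= (1 - a) + (1 - b)] for [a], [b] in [0, 1]. *)
Let p_exit_mulrn t x m : 0 <= t -> 1 - p (m%:R * t) x x <= m%:R * (1 - p t x x).
Proof.
move=> t0; elim: m => [|m IH]; first by rewrite !mul0r p0E eqxx subrr.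
have := p_mul x (mulr_ge0 (ler0n R m) t0) t0.
rewrite -natr1 mulrDl mul1r => h.
have a1 : 0 <= (1 - p (m%:R * t) x x) * (1 - p t x x).
  by rewrite mulr_ge0// subr_ge0.
lra.
Qed.

(* The exit probability [1 - p t x x] is subadditive in [t], so it lies below
   its tangent at [0]. *)
Lemma transition_exit_le t x : 0 <= t ->
  1 - fine (P t x [set x]) <= t * - G x x.
Proof.
rewrite le_eqVlt => /predU1P[<-|t0].
  by rewrite -/(p 0 x x) p0E eqxx subrr mul0r.
have [_ _ /(_ x x)/cvg_at_rightP h] := GP.
have hn : (forall m : nat, 0 < t / m.+1%:R) /\
    t / m.+1%:R @[m --> \oo] --> (0 : R).
  split=> [m|]; first by rewrite divr_gt0.
  by rewrite -[X in _ --> X](mulr0 t); apply: cvgMr; exact: cvg_harmonic.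
move/(_ (fun m => t / m.+1%:R)) : h => /(_ hn) h.
have /cvgr_to_ge : (t * - ((p (t / m.+1%:R) x x - p 0 x x) / (t / m.+1%:R)))
    @[m --> \oo] --> t * - G x x.
  by apply: cvgMr; apply: cvgN.
apply; apply: nearW => m.
have m0 : m.+1%:R != 0 :> R by rewrite pnatr_eq0.
have := p_exit_mulrn x m.+1 (ltW (hn.1 m)).
rewrite mulrCA divff// mulr1 -/(p t x x) p0E eqxx /=.
move=> /le_trans; apply; rewrite le_eqVlt; apply/orP; left; apply/eqP.
by field; rewrite nat1r m0 gt_eqF.
Qed.

(** Off the diagonal, [p t x y] is at most the exit probability, so the tangent bound controls every
    entry. The bound is uniform in [t] and [x], as dominated convergence requires. *)
Let p_rate t x y K : (forall x, `|G x x| <= K) -> 0 < t ->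
  `|(p t x y - p 0 x y) / t| <= K.
Proof.
move=> GK t0; rewrite normrM normfV (gtr0_norm t0) ler_pdivrMr//.
have GKx : 1 - p t x x <= K * t.
  rewrite (le_trans (transition_exit_le x (ltW t0)))// mulrC ler_wpM2r ?(ltW t0)//.
  apply: le_trans (GK x); by rewrite -normrN ler_norm.
rewrite (le_trans _ GKx)// p0E; have [<-|xy] := eqVneq x y.
  by rewrite distrC ger0_norm ?subr_ge0.
by rewrite subr0 ger0_norm// pxx_sub.
Qed.

(** By invariance the mean of [p t x y] over [pi] is the same for all [t >= 0], so each difference
    quotient has mean zero; the limit along [t = 1 / (m + 1)] passes under the integral by
    [p_rate]. *)
Lemma invariant_generator_eq0 (pi : probability T R) (K : R) (y : T) :
  is_invariant P pi -> (forall x, `|G x x| <= K) -> \int[pi]_x G x y = 0.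
Proof.
move=> Ppi GK.
pose q m x := (p m.+1%:R^-1 x y - p 0 x y) / m.+1%:R^-1.
have qK m x : `|q m x| <= K by rewrite p_rate// invr_gt0.
have qG x : q m x @[m --> \oo] --> G x y.
  have [_ _ /(_ x y)/cvg_at_rightP h] := GP.
  apply: h; split=> [m|]; first by rewrite invr_gt0.
  exact: cvg_harmonic.
have := bounded_Rintegral_cvg all_measurable (pi := pi) qK qG.
suff q0 m : \int[pi]_x q m x = 0.
  under eq_fun do rewrite q0.
  by move/(cvg_unique (@norm_hausdorff _ R^o)) => /(_ _ (cvg_cst _)) <-.
have bp t x : `|p t x y| <= 1 by rewrite ger0_norm.
have ip t : pi.-integrable setT (EFin \o (p t ^~ y)).
  exact: bounded_integrable (bp t).
have Ip t : 0 <= t -> \int[pi]_x p t x y = fine (pi [set y]).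
  move=> t0; rewrite -(Ppi t)// /Rintegral; congr fine.
  by apply: eq_integral => x _; rewrite pE.
rewrite /q RintegralZr//.
  by rewrite RintegralB// !Ip ?invr_ge0// subrr mul0r.
apply: (@bounded_integrable _ _ _ _ _ _ 1) => //= x.
by have := p_ge0 m.+1%:R^-1 x y; have := p_le1 m.+1%:R^-1 x y;
  have := p_ge0 0 x y; have := p_le1 0 x y; rewrite ler_norml; lra.
Qed.

End infinitesimal_stationarity.

(** * Drift of bounded functions *)

(* [0] when no element of [T] has code [i] *)
Definition enum_coef (R : realType) (T : countType) (f : T -> R) (i : nat) : R :=
  oapp f 0 (pickle_inv i).

Lemma enum_coefK (R : realType) (T : countType) (f : T -> R) (x : T) :
  enum_coef f (pickle x) = f x.
Proof. by rewrite /enum_coef pickleK_inv. Qed.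

(** Truncating by code turns any function into a finite combination of point indicators; identities
    known for indicators extend this way to bounded functions. *)
Lemma sum_enum_coef (R : realType) (T : countType) (f : T -> R) (m : nat) (x : T) :
  \sum_(i < m) enum_coef f i * (pickle x == i)%:R =
  if (pickle x < m)%N then f x else 0.
Proof.
case: ifPn => xm.
  rewrite (bigD1 (Ordinal xm))//= eqxx mulr1 enum_coefK big1 ?addr0// => i ix.
  rewrite (_ : _ == _ = false) ?mulr0//; apply: contraNF ix => /eqP xi.
  by apply/eqP/val_inj.
rewrite big1// => i _; rewrite (_ : _ == _ = false) ?mulr0//.
by apply: contraNF xm => /eqP ->.
Qed.

Lemma truncation_cvg (R : realType) (T : countType) (f : T -> R) (x : T) :
  (if (pickle x < m)%N then f x else 0) @[m --> \oo] --> f x.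
Proof.
apply: cvg_near_cst; exists (pickle x).+1 => // m /= xm.
by rewrite xm.
Qed.

Lemma cvg_sumr (R : realType) (I : Type) (r : seq I) (u : I -> nat -> R)
    (l : I -> R) : (forall i, u i m @[m --> \oo] --> l i) ->
  (\sum_(i <- r) u i m) @[m --> \oo] --> \sum_(i <- r) l i.
Proof.
move=> ul; elim: r => [|i r IH].
  by rewrite big_nil; under eq_fun do rewrite big_nil; exact: cvg_cst.
by rewrite big_cons; under eq_fun do rewrite big_cons; exact: cvgD.
Qed.

Section state_expectation.
Context (R : realType) (M : nat) (n : 'I_M -> nat).
Context (pi : probability (state n) R).

Lemma state_measurable (A : set (state n)) : measurable A.
Proof. by []. Qed.

(** Expands the mean of [f] under the image of [pi] by [t] along the point masses of that image. It
    serves to compare [t = id] with [t = permute tau]. *)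
Lemma Rintegral_comp_countable (t : state n -> state n) (f : state n -> R)
    (C : R) : (forall x, `|f x| <= C) ->
  (\sum_(i < m) enum_coef f i * \int[pi]_x (pickle (t x) == i)%:R)
    @[m --> \oo] --> \int[pi]_x f (t x).
Proof.
move=> fC.
have C0 : 0 <= C by apply: le_trans (fC [ffun=> 0%N]).
have bd m x : `|if (pickle (t x) < m)%N then f (t x) else 0| <= C.
  by case: ifP; rewrite ?normr0.
have := bounded_Rintegral_cvg state_measurable (pi := pi) bd
  (fun x => @truncation_cvg _ _ f (t x)).
apply: cvg_trans; apply: near_eq_cvg; apply: nearW => m /=.
under eq_Rintegral do rewrite -sum_enum_coef.
apply/esym.
rewrite (@bounded_Rintegral_sum _ _ _ state_measurable _ _ _ _
  (fun i : 'I_m => enum_coef f i) (fun i x => (pickle (t x) == i)%:R) 1)//.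
by move=> i x; case: (_ == _); rewrite ?normr1 ?normr0.
Qed.

End state_expectation.
Arguments state_measurable {M n}.

Section drift.
Context (R : realType) (M : nat) (n : 'I_M -> nat) (N : nat) (lambda : R).
Context (mu : 'I_M -> R).
Hypotheses (mu_gt0 : forall j, 0 < mu j) (lambda_ge0 : 0 <= lambda).
Implicit Types (Q : state n) (s : server n) (f : state n -> R).

(** The generator applied to the function [f], as a finite sum over servers instead of a sum over
    the countable state space. *)
Definition sajsq_drift f Q : R :=
  \sum_s arrival_rate N lambda Q s * (f (incr Q s) - f Q) +
  \sum_s service_rate mu Q s * (f (decr Q s) - f Q).

Lemma sajsq_generatorE Q Q' :
  sajsq_generator N lambda mu Q Q' = sajsq_drift (fun x => (x == Q')%:R) Q.
Proof.
by congr (_ + _); apply: eq_bigr => s _; rewrite ![Q' == _]eq_sym.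
Qed.

Lemma arrival_rate_ge0 Q s : 0 <= arrival_rate N lambda Q s.
Proof. by rewrite /arrival_rate; case: ifP => // _; rewrite divr_ge0 ?mulr_ge0. Qed.

Lemma arrival_rate_le Q s : arrival_rate N lambda Q s <= N%:R * lambda.
Proof.
have h : 0 <= N%:R * lambda by rewrite mulr_ge0.
rewrite /arrival_rate; case: ifP => // _.
(* An empty set of minimizers gives rate [0], because division by zero yields zero. *)
case: #|_| => [|c]; first by rewrite invr0 mulr0.
by rewrite ler_pdivrMr// ler_peMr// ler1n.
Qed.

Lemma service_rate_ge0 Q s : 0 <= service_rate mu Q s.
Proof. by rewrite /service_rate; case: ifP => // _; rewrite ltW. Qed.

Lemma service_rate_le Q s : service_rate mu Q s <= mu (tag s).
Proof. by rewrite /service_rate; case: ifP => // _; rewrite ltW. Qed.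

(** A crude bound on the total jump rate, charging the whole arrival stream to each server; what
    matters is that it does not depend on the state. *)
Definition max_total_rate : R := \sum_(s : server n) (N%:R * lambda + mu (tag s)).

Lemma sajsq_drift_le f (C : R) Q : (forall x, `|f x| <= C) ->
  `|sajsq_drift f Q| <= max_total_rate * (C + C).
Proof.
move=> fC; rewrite /max_total_rate big_split/= mulrDl.
have dC x y : `|f x - f y| <= C + C by rewrite (le_trans (ler_normB _ _))// lerD.
rewrite (le_trans (ler_normD _ _))// lerD// (le_trans (ler_norm_sum _ _ _))//
  mulr_suml ler_sum// => s _; rewrite normrM ler_pM// ger0_norm.
- exact: arrival_rate_le.
- exact: arrival_rate_ge0.
- exact: service_rate_le.
- exact: service_rate_ge0.
Qed.

Lemma eq_sajsq_drift f g Q : f =1 g -> sajsq_drift f Q = sajsq_drift g Q.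
Proof. by move=> fg; congr (_ + _); apply: eq_bigr => s _; rewrite !fg. Qed.

Lemma sajsq_drift_sum (I : Type) (r : seq I) (c : I -> R) (f : I -> state n -> R) Q :
  sajsq_drift (fun x => \sum_(i <- r) c i * f i x) Q =
  \sum_(i <- r) c i * sajsq_drift (f i) Q.
Proof.
rewrite /sajsq_drift; under [RHS]eq_bigr do rewrite mulrDr !mulr_sumr.
rewrite big_split/= [X in _ = X + _]exchange_big [X in _ = _ + X]exchange_big/=.
by congr (_ + _); apply: eq_bigr => s _; rewrite -sumrB mulr_sumr;
  apply: eq_bigr => i _; ring.
Qed.

Lemma sajsq_drift_cvg (f_ : nat -> state n -> R) f Q :
  (forall x, f_ m x @[m --> \oo] --> f x) ->
  sajsq_drift (f_ m) Q @[m --> \oo] --> sajsq_drift f Q.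
Proof.
move=> cf; apply: cvgD; apply: cvg_sumr => s; apply: cvgMr;
  exact: cvgB.
Qed.

Section stationary.
Context (pi : probability (state n) R).
Hypothesis pi_stat : is_stationary (sajsq_generator N lambda mu) pi.

(** Indexing by codes matches the terms of [sum_enum_coef]. A code of no state gives the zero
    function; otherwise this is [invariant_generator_eq0] at the decoded state. *)
Lemma Rintegral_drift_indicator (i : nat) :
  \int[pi]_x sajsq_drift (fun y => (pickle y == i)%:R) x = 0.
Proof.
have [P [GP Ppi]] := pi_stat.
case E : (@pickle_inv (state n) i) => [y|]; last first.
  have ni (y : state n) : (pickle y == i) = false.
    by apply/eqP => yi; move: E; rewrite -yi pickleK_inv.
  under eq_Rintegral => x _.
    under eq_sajsq_drift do rewrite ni.
    rewrite /sajsq_drift subrr !big1 ?addr0; first over.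
    - by move=> s _; rewrite mulr0.
    - by move=> s _; rewrite mulr0.
  by rewrite Rintegral_cst// mul0r.
have := @pickle_invK (state n) i; rewrite E /= => <-.
rewrite -[RHS](invariant_generator_eq0 state_measurable GP
  (K := max_total_rate * (1 + 1)) y Ppi) => [|x]; last first.
  rewrite sajsq_generatorE sajsq_drift_le// => z.
  by case: (_ == _); rewrite ?normr1 ?normr0.
apply: eq_Rintegral => x _; rewrite sajsq_generatorE.
by apply: eq_sajsq_drift => z; rewrite (inj_eq (pcan_inj pickleK)).
Qed.

(** True for truncations of [f] by linearity; the drifts of the truncations are uniformly bounded,
    so dominated convergence removes the truncation. *)
Lemma Rintegral_drift_eq0 f (C : R) : (forall x, `|f x| <= C) ->
  \int[pi]_x sajsq_drift f x = 0.
Proof.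
move=> fC; have C0 : 0 <= C by apply: le_trans (fC [ffun=> 0%N]).
pose f_ m x := if (pickle x < m)%N then f x else 0.
have bd m x : `|f_ m x| <= C by rewrite /f_; case: ifP; rewrite ?normr0.
have := bounded_Rintegral_cvg state_measurable (pi := pi)
  (fun m x => sajsq_drift_le x (bd m))
  (fun x => @sajsq_drift_cvg f_ f x (@truncation_cvg _ _ f)).
have E m : \int[pi]_x sajsq_drift (f_ m) x = 0.
  under eq_Rintegral => x _.
    rewrite (eq_sajsq_drift _ (fun y => esym (sum_enum_coef f m y))).
    rewrite sajsq_drift_sum; over.
  rewrite (@bounded_Rintegral_sum _ _ _ state_measurable _ _ _ _
    (fun i : 'I_m => enum_coef f i) _ (max_total_rate * (1 + 1))).
    by rewrite big1// => i _; rewrite Rintegral_drift_indicator mulr0.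
  move=> i x; apply: sajsq_drift_le => y.
  by case: (_ == _); rewrite ?normr1 ?normr0.
under eq_fun do rewrite E.
by move/(cvg_unique (@norm_hausdorff _ R^o)) => /(_ _ (cvg_cst _)) <-.
Qed.

End stationary.
End drift.

(** * Exchangeability of the servers of a pool *)

Section permutation.
Context (M : nat) (n : 'I_M -> nat) (tau : server n -> server n).
Hypotheses (tauK : involutive tau) (tag_tau : forall s, tag (tau s) = tag s).
Implicit Types (Q : state n) (s : server n) (j : 'I_M).

Definition permute Q : state n := [ffun s => Q (tau s)].

(** Minimality is restated over servers rather than over indices in a pool, because [tau] acts on
    servers. *)
Definition is_global_min Q s := [forall r, (Q s <= Q r)%N].
Definition is_pool_min Q s :=
  [forall r : server n, (tag r == tag s) ==> (Q s <= Q r)%N].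

Lemma permuteK : involutive permute.
Proof. by move=> Q; apply/ffunP => s; rewrite !ffunE tauK. Qed.

Lemma mkserver_tagged s : mkserver (tagged s) = s.
Proof. by case: s. Qed.

Lemma has_global_minE Q j :
  has_global_min Q j = [exists s, (tag s == j) && is_global_min Q s].
Proof.
apply/existsP/existsP => [[i ij]|[s /andP[/eqP <-]]].
  by exists (mkserver i); rewrite eqxx.
by exists (tagged s); rewrite mkserver_tagged.
Qed.

Lemma mem_pool_argmin Q s :
  (tagged s \in pool_argmin Q (tag s)) = is_pool_min Q s.
Proof.
rewrite inE mkserver_tagged; apply/forallP/forallP => [h r|h i].
  by case: r => k i; apply/implyP => /= /eqP ks; subst k; exact: h.
by have /implyP := h (mkserver i); apply; rewrite eqxx.
Qed.

Lemma card_pool_argmin Q j :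
  #|pool_argmin Q j| = #|[set s : server n | (tag s == j) && is_pool_min Q s]%SET|.
Proof.
pose e (i : 'I_(n j)) := mkserver i.
have e_inj : injective e by exact: eq_from_Tagged.
rewrite -(card_imset _ e_inj); apply: eq_card => s; rewrite inE.
apply/imsetP/andP => [[i ij ->]|[/eqP sj smin]].
  by split=> //; rewrite -mem_pool_argmin.
subst j; exists (tagged s); last by rewrite /e mkserver_tagged.
by rewrite mem_pool_argmin.
Qed.

Let tau_inj : injective tau := inv_inj tauK.

Lemma is_global_min_permute Q s :
  is_global_min (permute Q) s = is_global_min Q (tau s).
Proof.
by apply/forallP/forallP => h r; have := h (tau r); rewrite !ffunE ?tauK.
Qed.

Lemma is_pool_min_permute Q s :
  is_pool_min (permute Q) s = is_pool_min Q (tau s).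
Proof.
by apply/forallP/forallP => h r; have := h (tau r); rewrite !ffunE ?tauK !tag_tau.
Qed.

Lemma has_global_min_permute Q j :
  has_global_min (permute Q) j = has_global_min Q j.
Proof.
rewrite !has_global_minE; apply/existsP/existsP => -[s] sj; exists (tau s);
  by move: sj; rewrite is_global_min_permute ?tauK tag_tau.
Qed.

Lemma is_jdagger_permute Q j : is_jdagger (permute Q) j = is_jdagger Q j.
Proof.
rewrite /is_jdagger has_global_min_permute; congr (_ && _).
by apply: eq_forallb => k; rewrite has_global_min_permute.
Qed.

Lemma card_pool_argmin_permute Q j :
  #|pool_argmin (permute Q) j| = #|pool_argmin Q j|.
Proof.
rewrite !card_pool_argmin -[RHS](card_preimset _ tau_inj).
by apply: eq_card => s; rewrite !inE is_pool_min_permute tag_tau.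
Qed.

Lemma incr_permute Q s : incr (permute Q) s = permute (incr Q (tau s)).
Proof. by apply/ffunP => r; rewrite !ffunE (inj_eq tau_inj). Qed.

Lemma decr_permute Q s : decr (permute Q) s = permute (decr Q (tau s)).
Proof. by apply/ffunP => r; rewrite !ffunE (inj_eq tau_inj). Qed.

(** The rates depend on a server only through its pool and the queue lengths, so relabelling servers
    within pools commutes with the generator. *)
Lemma sajsq_drift_permute (R : realType) (N : nat) (lambda : R) (mu : 'I_M -> R)
    (f : state n -> R) Q :
  sajsq_drift N lambda mu (f \o permute) Q =
  sajsq_drift N lambda mu f (permute Q).
Proof.
rewrite /sajsq_drift; congr (_ + _); rewrite [LHS](reindex_inj tau_inj)/=;
  apply: eq_bigr => s _.
  rewrite incr_permute; congr (_ * _); rewrite /arrival_rate !mem_pool_argmin.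
  by rewrite tag_tau is_jdagger_permute card_pool_argmin_permute is_pool_min_permute.
by rewrite decr_permute; congr (_ * _); rewrite /service_rate tag_tau ffunE.
Qed.

End permutation.

(** * Invariance of a stationary law under permutations within pools *)

Section exchangeability.
Context (R : realType) (M : nat) (n : 'I_M -> nat) (N : nat) (lambda : R).
Context (mu : 'I_M -> R).
Hypotheses (mu_gt0 : forall j, 0 < mu j) (lambda_ge0 : 0 <= lambda).
Context (pi : probability (state n) R).
Hypothesis pi_stat : is_stationary (sajsq_generator N lambda mu) pi.
Context (tau : server n -> server n).
Hypotheses (tauK : involutive tau) (tag_tau : forall s, tag (tau s) = tag s).
Implicit Types (x y : state n).

(** [a] and [b] are the point masses of [pi] and of its image under [permute tau]; [A] is the set
    where [pi] is strictly heavier. The drift [L] of the indicator of [A] is nonpositive on [A] and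
    nonnegative off it, hence opposite in sign to [a - b]. *)
Let a x : R := \int[pi]_z (pickle z == pickle x)%:R.
Let b x : R := \int[pi]_z (pickle (permute tau z) == pickle x)%:R.
Let A x : bool := b x < a x.
Let L := sajsq_drift N lambda mu (fun x => (A x)%:R).

Let L_le0 x : A x -> L x <= 0.
Proof.
move=> Ax; rewrite /L /sajsq_drift Ax -[leRHS]addr0 lerD//; apply: sumr_le0 => s _;
  rewrite mulr_ge0_le0 ?arrival_rate_ge0 ?service_rate_ge0//;
  by case: (A _); rewrite ?subrr// sub0r oppr_le0.
Qed.

Let L_ge0 x : ~~ A x -> 0 <= L x.
Proof.
move=> /negbTE Ax; rewrite /L /sajsq_drift Ax addr_ge0//; apply: sumr_ge0 => s _;
  by rewrite mulr_ge0 ?arrival_rate_ge0 ?service_rate_ge0// subr0.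
Qed.

Let A_bound x : `|(A x)%:R : R| <= 1.
Proof. by case: (A x); rewrite ?normr1 ?normr0. Qed.

Let term_le0 x : L x * (a x - b x) <= 0.
Proof.
have [Ax|Ax] := boolP (A x).
  by rewrite mulr_le0_ge0 ?L_le0// subr_ge0 ltW.
by rewrite mulr_ge0_le0 ?L_ge0// subr_le0 leNgt.
Qed.

(* Stationarity of both [pi] and its image under [permute tau] makes these
   nonpositive terms sum to [0]. *)
Let term_eq0 x : L x * (a x - b x) = 0.
Proof.
have LC := fun x => sajsq_drift_le N mu_gt0 lambda_ge0 x A_bound.
have h1 := Rintegral_comp_countable (pi := pi) (t := id) LC.
have h2 := Rintegral_comp_countable (pi := pi) (t := permute tau) LC.
rewrite /= (Rintegral_drift_eq0 mu_gt0 lambda_ge0 pi_stat A_bound) in h1.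
have e2 : \int[pi]_x L (permute tau x) = 0.
  under eq_Rintegral do rewrite /L -(sajsq_drift_permute tauK tag_tau).
  by apply: (Rintegral_drift_eq0 mu_gt0 lambda_ge0 pi_stat (C := 1)) => y; exact: A_bound.
rewrite e2 in h2.
have := cvgB h1 h2; rewrite subrr => /(_ _) h.
apply/eqP; rewrite eq_le term_le0/=.
(* Once a partial sum contains the term of [x], it is at most that term; its limit [0] is then at
   most that term too. *)
apply: (cvgr_to_le h); exists (pickle x).+1 => // m /= xm.
rewrite !fctE -sumrB (bigD1 (Ordinal xm))//= -mulrBr enum_coefK.
rewrite gerDl sumr_le0// => i _; rewrite -mulrBr /enum_coef.
case E : pickle_inv => [y|] /=; last by rewrite mul0r.
have := @pickle_invK (state n) i; rewrite E /= => <-.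
exact: term_le0.
Qed.

(* A vanishing drift means that no jump leaves [A]; draining all queues would
   then put the empty state in [A], but the empty state is fixed by
   [permute tau]. *)
Let A_decr x s : A x -> (0 < x s)%N -> A (decr x s).
Proof.
move=> Ax xs; have /eqP := term_eq0 x.
rewrite mulf_eq0 [a x - b x == 0]subr_eq0 (gt_eqF Ax) orbF => /eqP Lx0.
apply: contraT => nA.
suff : L x < 0 by rewrite Lx0 ltxx.
rewrite /L /sajsq_drift Ax -[ltRHS]addr0 ler_ltD//.
  apply: sumr_le0 => r _; rewrite mulr_ge0_le0 ?arrival_rate_ge0//.
  by case: (A _); rewrite ?subrr// sub0r oppr_le0.
rewrite (bigD1 s)//= -[ltRHS]addr0 ltr_leD//.
  by rewrite /service_rate xs (negbTE nA) sub0r mulrN1 oppr_lt0.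
apply: sumr_le0 => r _; rewrite mulr_ge0_le0 ?service_rate_ge0//.
by case: (A _); rewrite ?subrr// sub0r oppr_le0.
Qed.

Let A_empty x : ~~ A x.
Proof.
have [k] := ubnP (\sum_s x s)%N; elim: k x => // k IH x xk.
apply/negP => Ax; case: (boolP [exists s, (0 < x s)%N]) => [/existsP[s xs]|].
  apply/negP: (A_decr Ax xs); apply: IH.
  move: xk; rewrite ltnS; apply: leq_trans.
  rewrite (bigD1 s)//= [ltnRHS](bigD1 s)//= -addSn leq_add//.
    by rewrite ffunE eqxx subn1 prednK.
  by apply: leq_sum => r _; rewrite ffunE leq_subr.
rewrite negb_exists => /forallP x0.
have px : permute tau x = x.
  apply/ffunP => s; rewrite ffunE.
  by have := x0 s; have := x0 (tau s); rewrite -!eqn0Ngt => /eqP -> /eqP ->.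
move: Ax; rewrite /A /a /b; under eq_Rintegral => z _.
  rewrite (inj_eq (pcan_inj pickleK)) -(inj_eq (inv_inj (permuteK tauK))).
  rewrite (permuteK tauK) px -(inj_eq (pcan_inj pickleK)); over.
by rewrite ltxx.
Qed.

Lemma Rintegral_permute (f : state n -> R) (C : R) : (forall x, `|f x| <= C) ->
  \int[pi]_x f (permute tau x) = \int[pi]_x f x.
Proof.
move=> fC.
(* [A_empty] gives [a <= b] everywhere. Since [permute tau] exchanges [a] and [b], the same
   inequality at [permute tau x] is the converse one at [x]. *)
have ab x : a x = b x.
  have ba y : b (permute tau y) = a y.
    apply: eq_Rintegral => z _; rewrite !(inj_eq (pcan_inj pickleK)).
    by rewrite (inj_eq (inv_inj (permuteK tauK))).
  apply/eqP; rewrite eq_le leNgt A_empty/=.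
  by rewrite -ba -[b x](_ : a (permute tau x) = _) ?leNgt ?A_empty// -ba permuteK.
have h1 := Rintegral_comp_countable (pi := pi) (t := id) fC.
have h2 := Rintegral_comp_countable (pi := pi) (t := permute tau) fC.
apply: (cvg_unique (@norm_hausdorff _ R^o) h2).
apply: cvg_trans h1; apply: near_eq_cvg; apply: nearW => m /=.
apply: eq_bigr => i _; rewrite /enum_coef.
case E : pickle_inv => [y|] /=; last by rewrite !mul0r.
by have := @pickle_invK (state n) i; rewrite E /= => <-; congr (_ * _); exact: ab.
Qed.

End exchangeability.

(** * Geometric decay of the tails *)

Section tail_bound.
Context (R : realType) (M : nat) (n : 'I_M -> nat) (N : nat) (lambda : R).
Context (mu gamma : 'I_M -> R).
Hypotheses (mu_gt0 : forall j, 0 < mu j) (lambda_ge0 : 0 <= lambda).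
Hypothesis gammamu : \sum_(j < M) gamma j * mu j = 1.
Hypothesis sizes : pool_sizes gamma N n.
Implicit Types (Q : state n) (s : server n).

Lemma sum_server (F : server n -> R) :
  \sum_s F s = \sum_(j < M) \sum_(i < n j) F (mkserver i).
Proof.
pose F' j (i : 'I_(n j)) := F (mkserver i).
rewrite (sig_big_dep (J := fun j => 'I_(n j)) xpredT (fun=> xpredT) F')/=.
by apply: eq_bigr => s _; rewrite /F' mkserver_tagged.
Qed.

Lemma total_service_rate : \sum_(s : server n) mu (tag s) = N%:R.
Proof.
transitivity (N%:R * \sum_(j < M) gamma j * mu j); last by rewrite gammamu mulr1.
rewrite sum_server mulr_sumr.
apply: eq_bigr => j _ /=.
by rewrite sumr_const card_ord -[LHS]mulr_natl (sizes j).2 mulrA.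
Qed.

(** At most one pool satisfies [is_jdagger], and its shortest queues share [N * lambda] equally. The
    inequality also covers the degenerate cases, where the sum is [0]. *)
Lemma total_arrival_rate_le Q : \sum_s arrival_rate N lambda Q s <= N%:R * lambda.
Proof.
have h : 0 <= N%:R * lambda by rewrite mulr_ge0.
rewrite sum_server; case: (pickP (is_jdagger Q)) => [j jQ|no]; last first.
  by rewrite big1// => j _; rewrite big1// => i _; rewrite /arrival_rate no.
rewrite (bigD1 j)//= [X in _ + X]big1 ?addr0 => [|k kj]; last first.
  rewrite big1// => i _; rewrite /arrival_rate /= ifF//.
  apply: contraNF kj => /andP[kQ _]; apply/eqP/val_inj/eqP => /=.
  have /andP[jm /forallP/(_ k)/implyP jk] := jQ.
  have /andP[km /forallP/(_ j)/implyP kj] := kQ.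
  by rewrite eqn_leq jk ?kj.
under eq_bigr do rewrite /arrival_rate/= jQ/=.
rewrite -big_mkcond sumr_const -[leLHS]mulr_natr.
case: #|_| => [|c]; first by rewrite mulr0.
by rewrite divfK ?pnatr_eq0.
Qed.

(** The chosen server is minimal in its pool, and that pool contains a global minimum. *)
Lemma arrival_rate_neq0_min Q s r :
  arrival_rate N lambda Q s != 0 -> (Q s <= Q r)%N.
Proof.
rewrite /arrival_rate; case: ifP => [|_]; rewrite ?eqxx// mem_pool_argmin.
move=> /andP[/andP[+ _] /forallP smin] _; rewrite has_global_minE.
move=> /existsP[t /andP[ts /forallP tmin]].
by apply: leq_trans (tmin r); have /implyP := smin t; apply.
Qed.

(** Its mean under the stationary law is the [T l] of the opening comment. *)
Definition tail_rate (l : nat) Q : R := \sum_(s : server n) mu (tag s) * (l <= Q s)%N%:R.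

Lemma tail_rate_ge0 l Q : 0 <= tail_rate l Q.
Proof. by apply: sumr_ge0 => s _; rewrite mulr_ge0// ltW. Qed.

Lemma tail_rate_le l Q : tail_rate l Q <= N%:R.
Proof.
rewrite -total_service_rate ler_sum// => s _.
by rewrite ler_piMr ?(ltW (mu_gt0 _))// lern1 leq_b1.
Qed.

(** If some arrival can join a queue of length at least [l], then all queues are that long and
    [tail_rate l Q] equals [N]; otherwise the left side is [0]. *)
Lemma arrival_tail_le l Q :
  \sum_s arrival_rate N lambda Q s * (l <= Q s)%N%:R <= lambda * tail_rate l Q.
Proof.
case: (pickP (fun s => (arrival_rate N lambda Q s != 0) && (l <= Q s)%N)).
  move=> s /andP[s0 ls].
  rewrite /tail_rate; under [X in _ <= _ * X]eq_bigr => r _.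
    rewrite (leq_trans ls (arrival_rate_neq0_min r s0)) mulr1; over.
  rewrite total_service_rate mulrC; apply: le_trans (total_arrival_rate_le Q).
  apply: ler_sum => r _; rewrite ler_piMr ?arrival_rate_ge0//.
  by case: (_ <= _)%N.
move=> no; rewrite big1 ?mulr_ge0 ?tail_rate_ge0// => s _.
have /negbT := no s; rewrite negb_and negbK => /orP[/eqP ->|/negbTE ->].
  by rewrite mul0r.
by rewrite mulr0.
Qed.

(** The number of levels in [l, l + m) lying below [q]. The cap at [l + m] keeps the test function
    bounded, and the truncated subtraction is exact. *)
Definition window (l m q : nat) : nat := minn q (l + m) - minn q l.

Lemma windowS l m q : window l m q.+1 = (window l m q + (l <= q < l + m))%N.
Proof. rewrite /window; lia. Qed.

Lemma window_le l m q : (window l m q <= m)%N.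
Proof. rewrite /window; lia. Qed.

Definition window_sum l m Q : R := \sum_s (window l m (Q s))%:R.

Lemma window_sum_le l m Q : `|window_sum l m Q| <= \sum_(s : server n) m%:R.
Proof.
rewrite ger0_norm ?sumr_ge0// ler_sum// => s _.
by rewrite ler_nat window_le.
Qed.

Lemma window_sum_incr l m Q s :
  window_sum l m (incr Q s) - window_sum l m Q = (l <= Q s < l + m)%N%:R.
Proof.
rewrite /window_sum -sumrB (bigD1 s)//= big1 ?addr0 => [|r rs].
  by rewrite ffunE eqxx addn1 windowS natrD addrC addKr.
by rewrite ffunE (negbTE rs) addn0 subrr.
Qed.

Lemma window_sum_decr l m Q s : (0 < Q s)%N ->
  window_sum l m (decr Q s) - window_sum l m Q = - (l < Q s <= l + m)%N%:R.
Proof.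
(* A departure from a nonempty server undoes an arrival, which shifts the range of levels by one. *)
move=> Qs; have QE : incr (decr Q s) s = Q.
  apply/ffunP => r; rewrite !ffunE; case: eqP => [->|_]; first by rewrite subnK.
  by rewrite addn0 subn0.
have := window_sum_incr l m (decr Q s) s; rewrite QE => h; rewrite -opprB h.
rewrite ffunE eqxx; congr (- _%:R); congr nat_of_bool.
lia.
Qed.

(** The departure part of the drift is exactly minus the left side, also at empty servers, where
    [l < 0] fails. In the arrival part the upper cutoff is dropped before [arrival_tail_le]. *)
Lemma drift_window_sum l m Q :
  \sum_(s : server n) mu (tag s) * (l < Q s <= l + m)%N%:R <=
  lambda * tail_rate l Q - sajsq_drift N lambda mu (window_sum l m) Q.
Proof.
rewrite lerBrDr /sajsq_drift addrCA -big_split/= [X in _ + X]big1 ?addr0.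
  apply: le_trans (arrival_tail_le l Q); apply: ler_sum => s _.
  rewrite window_sum_incr ler_wpM2l ?arrival_rate_ge0// ler_nat.
  by case: (l <= Q s)%N => //=; case: (_ < _)%N.
move=> s _; rewrite /service_rate; case: ifPn => [Qs|].
  by rewrite window_sum_decr// mulrN subrr.
by rewrite -eqn0Ngt => /eqP ->; rewrite /= mulr0 mul0r addr0.
Qed.

Context (pi : probability (state n) R).
Hypothesis pi_stat : is_stationary (sajsq_generator N lambda mu) pi.

Lemma Rintegral_tail_rateS l :
  \int[pi]_x tail_rate l.+1 x <= lambda * \int[pi]_x tail_rate l x.
Proof.
pose u m Q : R := \sum_(s : server n) mu (tag s) * (l < Q s <= l + m)%N%:R.
have u_ge0 m Q : 0 <= u m Q.
  by apply: sumr_ge0 => s _; rewrite mulr_ge0// ltW.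
have u_le m Q : `|u m Q| <= N%:R.
  rewrite ger0_norm// -total_service_rate ler_sum// => s _.
  by rewrite ler_piMr ?(ltW (mu_gt0 _))// lern1 leq_b1.
have u_cvg Q : u m Q @[m --> \oo] --> tail_rate l.+1 Q.
  apply: cvg_sumr => s; apply: cvgMr; apply: cvg_near_cst.
  by exists (Q s) => // m /= Qm; rewrite (leq_trans Qm (leq_addl _ _)) andbT.
have := bounded_Rintegral_cvg state_measurable (pi := pi) u_le u_cvg.
move/cvgr_to_le; apply; apply: nearW => m.
have iw : pi.-integrable setT (EFin \o tail_rate l).
  apply: (@bounded_integrable _ _ _ state_measurable _ _ N%:R) => x.
  by rewrite ger0_norm ?tail_rate_ge0 ?tail_rate_le.
have Lb := fun x => sajsq_drift_le N mu_gt0 lambda_ge0 x (window_sum_le l m).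
have iu : pi.-integrable setT (EFin \o u m).
  exact: (@bounded_integrable _ _ _ state_measurable _ _ _ (u_le m)).
have iL : pi.-integrable setT (EFin \o sajsq_drift N lambda mu (window_sum l m)).
  exact: (@bounded_integrable _ _ _ state_measurable _ _ _ Lb).
have iv : pi.-integrable setT (EFin \o (fun x => lambda * tail_rate l x)).
  apply: (@bounded_integrable _ _ _ state_measurable _ _ (lambda * N%:R)) => x.
  by rewrite normrM ger0_norm// ger0_norm ?tail_rate_ge0// ler_wpM2l ?tail_rate_le.
(* The subtracted [0] is rewritten as the mean drift of the window sum, so that [drift_window_sum]
   can be integrated. *)
rewrite -[leRHS]subr0.
rewrite -[X in _ - X](Rintegral_drift_eq0 mu_gt0 lambda_ge0 pi_stat (window_sum_le l m)).
rewrite -RintegralZl// -RintegralB//.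
apply: le_Rintegral => //.
  exact: (integrableB measurableT iv iL).
by move=> x _; exact: drift_window_sum.
Qed.

Lemma Rintegral_tail_rate_le l :
  \int[pi]_x tail_rate l x <= lambda ^+ l * N%:R.
Proof.
elim: l => [|l IH].
  rewrite expr0 mul1r; under eq_Rintegral => x _.
    rewrite (_ : tail_rate 0 x = N%:R); first over.
    by rewrite -total_service_rate; apply: eq_bigr => s _; rewrite mulr1.
  by rewrite Rintegral_cst// [X in fine X](probability_setT pi) mulr1.
rewrite exprS -mulrA (le_trans (Rintegral_tail_rateS l))//.
by rewrite ler_wpM2l.
Qed.

(** Exchangeability applied to the transposition of the two servers. *)
Lemma Rintegral_tail_server l j (i i' : 'I_(n j)) :
  \int[pi]_x (l <= x (mkserver i))%N%:R = \int[pi]_x (l <= x (mkserver i'))%N%:R.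
Proof.
pose tau : server n -> server n := tperm (mkserver i) (mkserver i').
have tauK : involutive tau by exact: tpermK.
have tag_tau s : tag (tau s) = tag s by rewrite /tau; case: tpermP => [->|->|].
rewrite -[LHS](Rintegral_permute mu_gt0 lambda_ge0 pi_stat tauK tag_tau
  (f := fun x => (l <= x (mkserver i))%N%:R) (C := 1)).
  by apply: eq_Rintegral => x _; rewrite ffunE /tau tpermL.
by move=> x; rewrite ger0_norm// lern1 leq_b1.
Qed.

(** Pool [j] alone contributes [N * gamma j] equal terms to the mean of [tail_rate l]; the other
    pools are dropped and [N] cancels. *)
Lemma prob_tail_server_le (N_gt0 : (0 < N)%N) l j (i : 'I_(n j)) :
  mu j * gamma j * \int[pi]_x (l <= x (mkserver i))%N%:R <= lambda ^+ l.
Proof.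
have N0 : 0 < N%:R :> R by rewrite ltr0n.
rewrite -(ler_pM2r N0); apply: le_trans (Rintegral_tail_rate_le l).
rewrite /tail_rate.
rewrite (@bounded_Rintegral_sum _ _ _ state_measurable _ _ _ _
  (fun s : server n => mu (tag s)) _ 1); last first.
  by move=> s x; rewrite ger0_norm// lern1 leq_b1.
rewrite sum_server (bigD1 j)//= -[leLHS]addr0 lerD//; last first.
  apply: sumr_ge0 => k _; apply: sumr_ge0 => i' _.
  by rewrite mulr_ge0 ?Rintegral_ge0// ltW.
under eq_bigr do rewrite (Rintegral_tail_server l _ i).
rewrite sumr_const card_ord -[leRHS]mulr_natr (sizes j).2.
by rewrite le_eqVlt; apply/orP; left; apply/eqP; ring.
Qed.

End tail_bound.

Theorem theorem8 (R : realType) (M : nat) (hM : (0 < M)%N)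
  (mu gamma : 'I_M -> R)
  (hmu : forall i j : 'I_M, (i < j)%N -> mu j < mu i)
  (hmu0 : forall j, 0 < mu j)
  (hgamma : forall j, 0 < gamma j <= 1)
  (hgamma1 : \sum_(j < M) gamma j = 1)
  (hgammamu : \sum_(j < M) gamma j * mu j = 1)
  (lambda : R) (hlambda0 : 0 < lambda) (hlambda1 : lambda < 1)
  (j : 'I_M) (k : nat) (hk : (1 <= k)%N) (l : nat) (hl : (1 <= l)%N)
  (theta : R) (htheta0 : 0 <= theta) (htheta1 : theta < - ln lambda) :
  let C := (1 - lambda) / (mu j * gamma j * (1 - lambda * expR theta)) in
  0 < C /\
  (ereal_sup [set p : \bar R |
     exists (N : nat) (n : 'I_M -> nat) (i : 'I_(n j))
            (pi : probability (state n) R),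
       [/\ (0 < N)%N,
           pool_sizes gamma N n,
           i.+1 = k,
           is_stationary (sajsq_generator N lambda mu) pi
         & p = pi [set Q : state n | (l <= Q (mkserver i))%N]]]
   <= (C * expR (- (l%:R * theta)))%:E)%E.
Proof.
have gj : 0 < gamma j by case/andP: (hgamma j).
have mg : 0 < mu j * gamma j by rewrite mulr_gt0.
have q_ge0 : 0 <= lambda * expR theta by rewrite mulr_ge0 ?expR_ge0 ?ltW.
(* With [lambda] written as [expR (ln lambda)], this is the hypothesis on [theta]. *)
have q_lt1 : lambda * expR theta < 1.
  by rewrite -[lambda]lnK ?posrE// -expRD expR_lt1 addrC -ltrBrDr sub0r.
have lq : lambda <= lambda * expR theta.
  by rewrite ler_peMr ?(ltW hlambda0)// -expR0 ler_expR.
have q0 : 0 < 1 - lambda * expR theta by rewrite subr_gt0.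
move=> C; split; first by rewrite divr_gt0 ?mulr_gt0 ?subr_gt0.
apply: ge_ereal_sup => _ [N [n [i [pi [N0 sizes _ stat ->]]]]].
set A := [set Q : state n | _].
have piA : pi A = (\int[pi]_x (l <= x (mkserver i))%N%:R)%:E.
  rewrite /Rintegral -[LHS]fineK ?fin_num_measure//; congr (fine _)%:E.
  rewrite -[A]setIT -integral_indic//; apply: eq_integral => x _.
  by rewrite indicE; congr (_%:R%:E); congr nat_of_bool; apply/idP/idP; rewrite inE.
have := prob_tail_server_le hmu0 (ltW hlambda0) hgammamu sizes stat N0 l i.
rewrite piA lee_fin; set p := Rintegral _ _ _ => pl.
have e : expR (- (l%:R * theta)) = (expR theta ^+ l)^-1.
  by rewrite expRN expRM_natl.
rewrite e ler_pdivlMr ?exprn_gt0 ?expR_gt0// /C ler_pdivlMr ?mulr_gt0//.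
(* Denominators are cleared; the factor before [1 - lambda * expR theta] is at most
   [(lambda * expR theta) ^+ l <= 1], and the last factor is at most [1 - lambda]. *)
have -> : p * expR theta ^+ l * (mu j * gamma j * (1 - lambda * expR theta)) =
  (mu j * gamma j * p) * expR theta ^+ l * (1 - lambda * expR theta) by ring.
apply: (@le_trans _ _ (1 * (1 - lambda * expR theta))); last by rewrite mul1r lerB.
rewrite ler_wpM2r// ?(ltW q0)//.
apply: (@le_trans _ _ (lambda ^+ l * expR theta ^+ l)).
  by rewrite ler_wpM2r// exprn_ge0// expR_ge0.
by rewrite -exprMn exprn_ile1// ltW.
Qed.
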